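(* Let $L=(L,\wedge,\vee,{}',0,1)$ be an ortholattice, let $\mathcal{F}(L)$ be its set of proper non-empty filters, and for $x,y\in\mathcal{F}(L)$ put $x\perp y$ iff there is a non-zero $a\in L$ with $a\in x$ and $a'\in y$. Then the map $h:L\to\mathcal{B}(\mathcal{F}(L),\perp)$, $h(a)=\{x\in\mathcal{F}(L):a\in x\}$, is the canonical completion (canonical extension) of the ortholattice $L$, where $\mathcal{B}(\mathcal{F}(L),\perp)$ carries the orthocomplementation $A\mapsto A^\perp$.
   Context: An ortholattice is a bounded lattice with an order-inverting complementation $'$ of period two. An orthoframe is a set $X$ with an irreflexive symmetric relation $\perp$ (the relation on $\mathcal{F}(L)$ in the claim is one). For $S\subseteq X$, $S^\perp=\{y\in X:x\perp y\text{ for all }x\in S\}$; $S$ is bi-orthogonally closed if $S=S^{\perp\perp}$. The set $\mathcal{B}(X)$ of bi-orthogonally closed subsets, ordered by inclusion, is a complete ortholattice with orthocomplement $S\mapsto S^\perp$, meets given by intersection, and joins given by the bi-orthogonal of the union. For a bounded lattice $L$, its canonical completion is a pair $(e,C)$ where $C$ is a complete lattice and $e:L\to C$ is a bounded lattice embedding that is dense (each element of $C$ is both a join of meets and a meet of joins of elements of the image of $L$) and compact (if $S,T\subseteq L$ and $\bigwedge e[S]\le\bigvee e[T]$, then $\bigwedge e[S']\le\bigvee e[T']$ for some finite $S'\subseteq S$ and $T'\subseteq T$). It is unique up to isomorphism. An element of $C$ is closed if it is a meet of elements of the image of $L$; $\mathcal{K}$ is the set of closed elements. For an ortholattice $L$,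 the canonical completion is $C$ equipped with the extended operation $$x^{'^\sigma}=\bigwedge\{\bigvee\{e(a'):k\le e(a)\}:k\le x,\ k\in\mathcal{K}\}.$$ *)

(* Defs.v *)
From HB Require Import structures.
From mathcomp Require Import all_boot all_order.
From mathcomp Require Import boolp classical_sets cardinality.

Set Implicit Arguments.
Unset Strict Implicit.
Unset Printing Implicit Defensive.

Import Order.TTheory.
Local Open Scope classical_set_scope.
Local Open Scope order_scope.

HB.mixin Record hasOrthocomplement (d : Order.disp_t) (L : Type)
    of Order.TBLattice d L := {
  ocompl : L -> L;
  ocomplK : involutive ocompl;
  le_ocompl : forall x y : L, x <= y -> ocompl y <= ocompl x;
  meet_ocompl : forall x : L, x `&` ocompl x = \bot;
  join_ocompl : forall x : L, x `|` ocompl x = \top }.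

#[short(type="orthoLatticeType")]
HB.structure Definition OrthoLattice d :=
  { L of hasOrthocomplement d L & Order.TBLattice d L }.

(* The operations below are determined by the order, so this structure is
   completeness of the lattice; bigjoin set0 = \bot and bigmeet set0 = \top. *)
HB.mixin Record hasArbitraryBounds (d : Order.disp_t) (C : Type)
    of Order.TBLattice d C := {
  bigjoin : set C -> C;
  bigmeet : set C -> C;
  bigjoin_isLub : forall A : set C,
    (forall x, A x -> x <= bigjoin A) /\
    (forall y, (forall x, A x -> x <= y) -> bigjoin A <= y);
  bigmeet_isGlb : forall A : set C,
    (forall x, A x -> bigmeet A <= x) /\
    (forall y, (forall x, A x -> y <= x) -> y <= bigmeet A) }.

#[short(type="completeLatticeType")]
HB.structure Definition CompleteLattice d :=
  { C of hasArbitraryBounds d C & Order.TBLattice d C }.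

(* A canonical completion is characterised up to isomorphism, so it is a
   predicate on e : L -> C; S and T below may be empty. *)
Section CanonicalCompletion.
Context {d d' : Order.disp_t}.

Definition bounded_lattice_embedding (L : tbLatticeType d)
    (C : tbLatticeType d') (e : L -> C) : Prop :=
  [/\ injective e, Order.meet_morphism e, Order.join_morphism e,
      e \bot = \bot & e \top = \top].

Definition closed_elements (L : tbLatticeType d) (C : completeLatticeType d')
    (e : L -> C) : set C := [set bigmeet (e @` S) | S in [set: set L]].

Definition open_elements (L : tbLatticeType d) (C : completeLatticeType d')
    (e : L -> C) : set C := [set bigjoin (e @` S) | S in [set: set L]].

Definition dense_embedding (L : tbLatticeType d) (C : completeLatticeType d')
    (e : L -> C) : Prop :=
  forall x : C,
    (exists2 A : set C, A `<=` closed_elements e & x = bigjoin A) /\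
    (exists2 A : set C, A `<=` open_elements e & x = bigmeet A).

Definition compact_embedding (L : tbLatticeType d) (C : completeLatticeType d')
    (e : L -> C) : Prop :=
  forall S T : set L, bigmeet (e @` S) <= bigjoin (e @` T) ->
    exists S' T' : set L,
      [/\ finite_set S', S' `<=` S, finite_set T', T' `<=` T &
          bigmeet (e @` S') <= bigjoin (e @` T')].

Definition canonical_completion (L : tbLatticeType d)
    (C : completeLatticeType d') (e : L -> C) : Prop :=
  [/\ bounded_lattice_embedding e, dense_embedding e & compact_embedding e].

(* For k closed, \bigjoin {e (a') | k <= e a} is the extension of the
   orthocomplement at k; it is then extended to any x by approximating x from
   below by closed elements. *)
Definition ocompl_sigma (L : orthoLatticeType d) (C : completeLatticeType d')
    (e : L -> C) (x : C) : C :=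
  bigmeet [set bigjoin [set e (ocompl a) | a in [set a : L | k <= e a]]
          | k in [set k : C | closed_elements e k /\ k <= x]].

Definition ortho_canonical_completion (L : orthoLatticeType d)
    (C : completeLatticeType d') (oc : C -> C) (e : L -> C) : Prop :=
  canonical_completion e /\ forall x : C, oc x = ocompl_sigma e x.

End CanonicalCompletion.

HB.mixin Record isOrthoFrame (X : Type) := {
  orth : X -> X -> Prop;
  orth_irr : forall x : X, ~ orth x x;
  orth_sym : forall x y : X, orth x y -> orth y x }.

#[short(type="orthoFrameType")]
HB.structure Definition OrthoFrame := { X of isOrthoFrame X }.

Definition orthset (X : orthoFrameType) (S : set X) : set X :=
  [set y | forall x, S x -> orth x y].

Lemma orthsetS (X : orthoFrameType) (S T : set X) :
  S `<=` T -> orthset T `<=` orthset S.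
Proof. by move=> ST y Ty x /ST; apply: Ty. Qed.

Lemma sub_biorth (X : orthoFrameType) (S : set X) :
  S `<=` orthset (orthset S).
Proof. by move=> x Sx y Sy; apply: orth_sym; apply: Sy. Qed.

Lemma orthset3 (X : orthoFrameType) (S : set X) :
  orthset (orthset (orthset S)) = orthset S.
Proof.
by apply/seteqP; split; [apply: orthsetS; apply: sub_biorth|apply: sub_biorth].
Qed.

Definition biorth_closed (X : orthoFrameType) (S : set X) : Prop :=
  S = orthset (orthset S).

(* The boolean reflection only serves to make this a subtype of set X, ordered
   by inclusion. *)
Record biclosed (X : orthoFrameType) := Biclosed {
  bcset :> set X;
  bcsetP : `[< biorth_closed bcset >] }.

Fact biclosed_display : Order.disp_t. Proof. exact: Order.Disp tt tt. Qed.

Section BiclosedLattice.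
Variable X : orthoFrameType.
Implicit Types (A B : biclosed X) (S : set X) (F : set (biclosed X)).

HB.instance Definition _ := [isSub for @bcset X].
HB.instance Definition _ := [Choice of biclosed X by <:].
HB.instance Definition _ :=
  [SubChoice_isSubPOrder of biclosed X by <: with biclosed_display].

Lemma bcset_closed A : bcset A = orthset (orthset (bcset A)).
Proof. exact/asboolP/bcsetP. Qed.

Lemma le_bcset A B : (A <= B) <-> (bcset A `<=` bcset B).
Proof. by rewrite -subsetEset Order.le_val. Qed.

Lemma orthset_closed S : biorth_closed (orthset S).
Proof. by rewrite /biorth_closed orthset3. Qed.

Definition bc_orth S : biclosed X := Biclosed (asboolT (orthset_closed S)).

Definition bc_closure S : biclosed X := bc_orth (orthset S).

Lemma bc_closure_le S A : (bc_closure S <= A) <-> (S `<=` bcset A).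
Proof.
split=> [/le_bcset + x Sx|SA]; first by apply; apply: sub_biorth.
by apply/le_bcset; rewrite (bcset_closed A); do 2!apply: orthsetS.
Qed.

Lemma bigcap_closed F : biorth_closed (\bigcap_(A in F) bcset A).
Proof.
apply/seteqP; split=> [|x xF A FA]; first exact: sub_biorth.
rewrite bcset_closed; move: xF; apply: orthsetS; apply: orthsetS.
by move=> y; apply.
Qed.

Definition bc_bigmeet F : biclosed X := Biclosed (asboolT (bigcap_closed F)).

Definition bc_bigjoin F : biclosed X := bc_closure (\bigcup_(A in F) bcset A).

Lemma bc_setI_closed A B : biorth_closed (bcset A `&` bcset B)%classic.
Proof.
apply/seteqP; split=> [|x xAB]; first exact: sub_biorth.
split; rewrite bcset_closed; move: xAB; apply: orthsetS; apply: orthsetS.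
  exact: subIsetl.
exact: subIsetr.
Qed.

Definition bc_meet A B : biclosed X := Biclosed (asboolT (bc_setI_closed A B)).

Definition bc_join A B : biclosed X := bc_closure (bcset A `|` bcset B)%classic.

Fact bc_lexI A B C : (A <= bc_meet B C) = (A <= B) && (A <= C).
Proof.
apply/idP/andP => [/le_bcset|[/le_bcset AB /le_bcset AC]].
  by rewrite subsetI => -[AB AC]; split; apply/le_bcset.
by apply/le_bcset; rewrite subsetI.
Qed.

Fact bc_leUx A B C : (bc_join A B <= C) = (A <= C) && (B <= C).
Proof.
apply/idP/andP => [/bc_closure_le|[/le_bcset AC /le_bcset BC]].
  by rewrite subUset => -[AC BC]; split; apply/le_bcset.
by apply/bc_closure_le; rewrite subUset.
Qed.

HB.instance Definition _ := Order.POrder_isMeetSemilattice.Build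
  biclosed_display (biclosed X) bc_lexI.
HB.instance Definition _ := Order.POrder_isJoinSemilattice.Build
  biclosed_display (biclosed X) bc_leUx.

Fact set0_closed : biorth_closed (set0 : set X).
Proof.
by apply/seteqP; split=> // x Hx; case: (@orth_irr X x); apply: Hx => y [].
Qed.

Fact setT_closed : biorth_closed [set: X].
Proof. by apply/seteqP; split=> // x _; apply: sub_biorth. Qed.

Definition bc_bot : biclosed X := Biclosed (asboolT set0_closed).
Definition bc_top : biclosed X := Biclosed (asboolT setT_closed).

Fact bc_le0x A : bc_bot <= A.
Proof. by apply/le_bcset. Qed.

Fact bc_lex1 A : A <= bc_top.
Proof. by apply/le_bcset. Qed.

HB.instance Definition _ := Order.hasBottom.Build
  biclosed_display (biclosed X) bc_le0x.
HB.instance Definition _ := Order.hasTop.Build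
  biclosed_display (biclosed X) bc_lex1.

Fact bc_bigjoin_isLub F :
  (forall A, F A -> A <= bc_bigjoin F) /\
  (forall B, (forall A, F A -> A <= B) -> bc_bigjoin F <= B).
Proof.
split=> [A FA|B FB].
  apply/le_bcset; apply: subset_trans (@sub_biorth X _).
  by move=> x Ax; exists A.
by apply/bc_closure_le => x [A /FB /le_bcset]; apply.
Qed.

Fact bc_bigmeet_isGlb F :
  (forall A, F A -> bc_bigmeet F <= A) /\
  (forall B, (forall A, F A -> B <= A) -> B <= bc_bigmeet F).
Proof.
split=> [A FA|B FB]; apply/le_bcset => x; first exact.
by move=> Bx A /FB /le_bcset; apply.
Qed.

HB.instance Definition _ := hasArbitraryBounds.Build
  biclosed_display (biclosed X) bc_bigjoin_isLub bc_bigmeet_isGlb.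

Definition bc_ocompl A : biclosed X := bc_orth (bcset A).

Fact bc_ocomplK : involutive bc_ocompl.
Proof. by move=> A; apply: val_inj => /=; rewrite -bcset_closed. Qed.

Fact bc_le_ocompl A B : A <= B -> bc_ocompl B <= bc_ocompl A.
Proof. by move=> /le_bcset AB; apply/le_bcset; apply: orthsetS. Qed.

Fact bc_meet_ocompl A : A `&` bc_ocompl A = \bot.
Proof.
apply: val_inj; apply/seteqP; split=> x //= -[Ax oAx].
by case: (@orth_irr X x); apply: oAx.
Qed.

Fact bc_join_ocompl A : A `|` bc_ocompl A = \top.
Proof.
apply/eqP; rewrite -le1x -[leRHS]bc_ocomplK -[leLHS]bc_ocomplK.
apply: bc_le_ocompl; have -> : bc_ocompl \top = \bot.
  apply: val_inj; apply/seteqP; split=> x //= Hx.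
  by case: (@orth_irr X x); apply: Hx.
suff <- : A `&` bc_ocompl A = \bot.
  rewrite lexI (bc_le_ocompl (leUl _ _)) andbT.
  by have := bc_le_ocompl (leUr (bc_ocompl A) A); rewrite bc_ocomplK.
exact: bc_meet_ocompl.
Qed.

HB.instance Definition _ := hasOrthocomplement.Build
  biclosed_display (biclosed X)
  bc_ocomplK bc_le_ocompl bc_meet_ocompl bc_join_ocompl.

End BiclosedLattice.

Record proper_filter (d : Order.disp_t) (L : tbLatticeType d) := ProperFilter {
  pfset :> set L;
  pf_nonempty : pfset !=set0;
  pf_proper : pfset <> [set: L];
  pf_up : forall a b : L, pfset a -> a <= b -> pfset b;
  pf_meet : forall a b : L, pfset a -> pfset b -> pfset (a `&` b) }.

Section FilterFrame.
Context {d : Order.disp_t} {L : orthoLatticeType d}.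
Implicit Types (x y : proper_filter L) (a b : L).

Definition pf_orth x y : Prop :=
  exists a : L, [/\ a <> \bot, pfset x a & pfset y (ocompl a)].

Lemma pf_bot x : ~ pfset x \bot.
Proof.
by move=> x0; apply: (@pf_proper _ _ x); apply/seteqP; split=> // a _;
  apply: pf_up x0 (le0x a).
Qed.

Lemma pf_top x : pfset x \top.
Proof. by have [a xa] := pf_nonempty x; apply: pf_up xa (lex1 a). Qed.

Fact pf_orth_irr x : ~ pf_orth x x.
Proof.
by case=> a [_ xa xa']; apply: (@pf_bot x); rewrite -(meet_ocompl a);
  apply: pf_meet.
Qed.

Fact pf_orth_sym x y : pf_orth x y -> pf_orth y x.
Proof.
case=> a [_ xa ya']; exists (ocompl a); split; rewrite ?ocomplK //.
by move=> a'0; apply: (@pf_bot y); rewrite -a'0.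
Qed.

HB.instance Definition _ :=
  isOrthoFrame.Build (proper_filter L) pf_orth_irr pf_orth_sym.

Definition filters_through a : set (proper_filter L) :=
  [set x | pfset x a].

Lemma ocompl_bot : ocompl (\bot : L) = \top.
Proof. by rewrite -(join_ocompl \bot) join0x. Qed.

Lemma orthset_filters_through a :
  orthset (filters_through a) = filters_through (ocompl a).
Proof.
apply/seteqP; split=> [y ay|y ya' x xa].
  have [a0|/eqP a0] := eqVneq a \bot.
    by rewrite /filters_through /= a0 ocompl_bot; apply: pf_top.
  have up_ne : [set b | a <= b] !=set0 by exists a => /=.
  have up_prop : [set b | a <= b] <> [set: L].
    move=> /seteqP[_ /(_ \bot I)] /=; rewrite lex0 => /eqP; exact: a0.
  have up_up b c : [set b | a <= b] b -> b <= c -> [set b | a <= b] c.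
    exact: le_trans.
  have up_meet b c : [set b | a <= b] b -> [set b | a <= b] c ->
      [set b | a <= b] (b `&` c).
    by move=> /= ab ac; rewrite lexI ab ac.
  have [|b [_ /= ab yb']] := ay (ProperFilter up_ne up_prop up_up up_meet).
    exact: lexx.
  by apply: pf_up yb' _; apply: le_ocompl.
exists a; split=> // a0; apply: (@pf_bot x); by rewrite -a0.
Qed.

Fact filters_through_closed a : biorth_closed (filters_through a).
Proof.
by rewrite /biorth_closed !orthset_filters_through ocomplK.
Qed.

Definition filter_embedding a : biclosed (proper_filter L) :=
  Biclosed (asboolT (filters_through_closed a)).

End FilterFrame.

(* Main.v *)
Require Import Defs.
From mathcomp Require Import all_boot all_order.
From mathcomp Require Import boolp classical_sets cardinality.

(** Write [e] for the map sending [a] to the set of proper filters through [a].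
    A biorthogonal set is upward closed for inclusion of filters, so it is the
    union, over its members [x], of the sets of filters extending [x]; each of
    these is the meet of the [e a] for [a] in [x].  Hence every element of the
    completion is the join of the closed elements below it
    ([closed_below_join]).  Since [e] commutes with orthocomplements
    ([filter_embedding_ocompl]) and De Morgan's laws hold in the completion,
    the dual statement, that every element is a meet of open elements, follows
    by complementation; so does the formula for the extended operation: it is
    the complement, computed by De Morgan, of a join of closed elements, each of
    which is the meet of the [e a] above it.

    Compactness is where the orthogonality relation matters.  If the meet of
    [e @` S] lies below the join of [e @` T], compare the filter generated by
    [S] with the filter generated by the complements of [T].  When both are
    proper, the hypothesis says exactly that they are orthogonal, so there is
    [a] in the first with [ocompl a] in the second, and membership in a
    generated filter only involves finitely many generators.  When one of them
    is improper, it contains [\bot], and [a := \bot] or [a := \top] works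
    ([compact_separation]). *)

Set Implicit Arguments.
Unset Strict Implicit.
Unset Printing Implicit Defensive.

Import Order.TTheory.
Local Open Scope classical_set_scope.
Local Open Scope order_scope.

(** * Bounds and De Morgan laws *)

Section CompleteLatticeTheory.
Context {d : Order.disp_t} {C : completeLatticeType d}.
Implicit Types (x : C) (A B : set C).

Lemma bigjoin_ub A x : A x -> x <= bigjoin A.
Proof. exact: (bigjoin_isLub A).1. Qed.

Lemma bigjoin_le A x : (forall y, A y -> y <= x) -> bigjoin A <= x.
Proof. exact: (bigjoin_isLub A).2. Qed.

Lemma bigmeet_lb A x : A x -> bigmeet A <= x.
Proof. exact: (bigmeet_isGlb A).1. Qed.

Lemma bigmeet_ge A x : (forall y, A y -> x <= y) -> x <= bigmeet A.
Proof. exact: (bigmeet_isGlb A).2. Qed.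

Lemma bigmeetS A B : A `<=` B -> bigmeet B <= bigmeet A.
Proof. by move=> AB; apply: bigmeet_ge => y /AB; apply: bigmeet_lb. Qed.

End CompleteLatticeTheory.

Section OrthoLatticeTheory.
Context {d : Order.disp_t} {L : orthoLatticeType d}.
Implicit Types a b : L.

Lemma ocompl_leC a b : (a <= ocompl b) = (b <= ocompl a).
Proof. by apply/idP/idP => /le_ocompl; rewrite ocomplK. Qed.

Lemma ocomplU a b : ocompl (a `|` b) = ocompl a `&` ocompl b.
Proof.
apply/le_anti/andP; split.
  by rewrite lexI !le_ocompl ?leUl ?leUr.
by rewrite ocompl_leC leUx ocompl_leC leIl ocompl_leC leIr.
Qed.

End OrthoLatticeTheory.

Section BiclosedTheory.
Context {X : orthoFrameType}.
Implicit Types F : set (biclosed X).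

Lemma ocompl_bigjoin F : ocompl (bigjoin F) = bigmeet (ocompl @` F).
Proof.
apply/le_anti/andP; split.
  by apply: bigmeet_ge => _ [A FA <-]; apply/le_ocompl/bigjoin_ub.
rewrite ocompl_leC; apply: bigjoin_le => A FA; rewrite ocompl_leC.
by apply: bigmeet_lb; exists A.
Qed.

Lemma ocompl_bigmeet F : ocompl (bigmeet F) = bigjoin (ocompl @` F).
Proof.
rewrite -[RHS]ocomplK ocompl_bigjoin image_comp; congr ocompl; congr bigmeet.
by rewrite -[LHS]image_id; apply: eq_imagel => A _ /=; rewrite ocomplK.
Qed.

End BiclosedTheory.

(** * The embedding of an ortholattice *)

Section FilterCompletion.
Context {d : Order.disp_t} {L : orthoLatticeType d}.
Implicit Types (a b : L) (S T : set L) (x y : proper_filter L).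

Local Notation C := (biclosed (proper_filter L)).
Local Notation e := (@filter_embedding d L).

Lemma filter_embedding_ocompl a : e (ocompl a) = ocompl (e a).
Proof. by apply: val_inj; rewrite /= orthset_filters_through. Qed.

Lemma filter_embedding_meet a b : e (a `&` b) = e a `&` e b.
Proof.
apply: val_inj; apply/seteqP; split=> x /=; last by case; apply: pf_meet.
by move=> xab; split; apply: pf_up xab _; [apply: leIl|apply: leIr].
Qed.

Lemma filter_embedding_join a b : e (a `|` b) = e a `|` e b.
Proof.
apply: (inv_inj ocomplK).
by rewrite -filter_embedding_ocompl !ocomplU filter_embedding_meet
  !filter_embedding_ocompl.
Qed.

Lemma filter_embedding_bot : e \bot = \bot.
Proof. by apply: val_inj; apply/seteqP; split=> x //= /pf_bot. Qed.

Lemma filter_embedding_top : e \top = \top.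
Proof. by apply: val_inj; apply/seteqP; split=> x //= _; apply: pf_top. Qed.

(** A non-zero element generates a proper principal filter, and this filter
    distinguishes it from every element that is not above it. *)
Lemma le_filter_embedding a b : (e a <= e b) = (a <= b).
Proof.
apply/idP/idP => [/le_bcset eab|ab]; last first.
  by apply/le_bcset => x /= xa; apply: pf_up xa ab.
have [->|/eqP a0] := eqVneq a \bot; first exact: le0x.
have up_ne : [set c | a <= c] !=set0 by exists a => /=.
have up_prop : [set c | a <= c] <> [set: L].
  by move=> /seteqP[_ /(_ \bot I)] /=; rewrite lex0 => /eqP.
have up_up c c' : a <= c -> c <= c' -> a <= c' by apply: le_trans.
have up_meet c c' : a <= c -> a <= c' -> a <= c `&` c'.
  by rewrite lexI => -> ->.
exact: (eab (ProperFilter up_ne up_prop up_up up_meet) (lexx a)).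
Qed.

Lemma filter_embedding_inj : injective e.
Proof.
by move=> a b eab; apply/le_anti; rewrite -!le_filter_embedding eab lexx.
Qed.

(** * Density and the extended orthocomplement *)

Lemma mem_bigmeet S x : bcset (bigmeet (e @` S)) x <-> S `<=` pfset x.
Proof.
split=> [xS a Sa|Sx _ [a Sa <-]]; last exact: Sx.
by apply: (xS (e a)); exists a.
Qed.

(** A witness of orthogonality to [x] remains one for every larger filter, so
    orthogonals are upward closed, and a biclosed set is an orthogonal. *)
Lemma biclosed_up (A : C) x y :
  pfset x `<=` pfset y -> bcset A x -> bcset A y.
Proof.
move=> xy; rewrite (bcset_closed A) => Ax z /Ax [a [a0 za xa']].
by exists a; split=> //; apply: xy.
Qed.

(** Even the set-theoretic union of the closed elements below [A] is all of
    [A]: each member [x] lies in the closed element cut out by [x] itself, which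
    is contained in [A] because [A] is upward closed. *)
Lemma closed_below_join (A : C) :
  A = bigjoin [set k | closed_elements e k /\ k <= A].
Proof.
apply/le_anti/andP; split; last by apply: bigjoin_le => k [].
apply/le_bcset => x Ax.
(* The members of this closed element are the filters extending [x]. *)
pose k : C := bigmeet (e @` pfset x).
suff /le_bcset : k <= bigjoin [set k | closed_elements e k /\ k <= A].
  by apply; apply/mem_bigmeet.
apply: bigjoin_ub; split; first by exists (pfset x).
by apply/le_bcset => y /mem_bigmeet xy; apply: biclosed_up xy Ax.
Qed.

Lemma ocompl_bigmeet_embedding S :
  ocompl (bigmeet (e @` S)) = bigjoin [set e (ocompl a) | a in S].
Proof.
rewrite ocompl_bigmeet image_comp; congr bigjoin.
by apply: eq_imagel => a _; rewrite filter_embedding_ocompl.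
Qed.

(** Complementation turns closed elements into open ones, so the second half
    is the first half for [ocompl A]. *)
Lemma filter_embedding_dense : dense_embedding e.
Proof.
move=> A; split.
  exists [set k | closed_elements e k /\ k <= A]; first by move=> k [].
  exact: closed_below_join.
exists (ocompl @` [set k | closed_elements e k /\ k <= ocompl A]).
  move=> _ [_ [[S _ <-] _] <-]; exists (ocompl @` S) => //.
  by rewrite ocompl_bigmeet_embedding image_comp.
by rewrite -ocompl_bigjoin -closed_below_join ocomplK.
Qed.

Lemma closed_above_meet (k : C) :
  closed_elements e k -> k = bigmeet (e @` [set a | k <= e a]).
Proof.
case=> S _ <-; apply/le_anti/andP; split.
  by apply: bigmeet_ge => _ [a ka <-].
apply: bigmeetS => _ [a Sa <-]; exists a => //=.
by apply: bigmeet_lb; exists a.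
Qed.

(** Complementing the join of the closed elements [k] below [A], and each [k]
    as the meet of the [e a] above it, yields the defining formula term by
    term. *)
Lemma ocompl_sigmaE (A : C) : ocompl A = ocompl_sigma e A.
Proof.
rewrite {1}(closed_below_join A) ocompl_bigjoin; congr bigmeet.
apply: eq_imagel => k [kc _].
by rewrite {1}(closed_above_meet kc) ocompl_bigmeet_embedding.
Qed.

(** * Compactness *)

(** The filter generated by [S], possibly improper.  Comparing finite meets in
    the completion instead of in [L] makes [\bot] a member exactly when some
    finite part of [S] already has meet [\bot] there, which is the form needed
    for compactness. *)
Definition generated S : set L :=
  [set a | exists U : set L,
    [/\ finite_set U, U `<=` S & bigmeet (e @` U) <= e a]].

Lemma sub_generated S : S `<=` generated S.
Proof.
move=> a Sa; exists [set a]; split; first exact: finite_set1.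
  by move=> _ ->.
by apply: bigmeet_lb; exists a.
Qed.

Lemma generated_top S : generated S \top.
Proof.
exists set0; split=> //.
by rewrite filter_embedding_top lex1.
Qed.

Lemma generated_up S a b : generated S a -> a <= b -> generated S b.
Proof.
move=> [U [Ufin US Ua]] ab; exists U; split=> //.
by apply: le_trans Ua _; rewrite le_filter_embedding.
Qed.

Lemma generated_meet S a b :
  generated S a -> generated S b -> generated S (a `&` b).
Proof.
move=> [U [Ufin US Ua]] [V [Vfin VS Vb]]; exists (U `|` V)%classic; split.
- by rewrite finite_setU.
- by rewrite subUset.
- rewrite filter_embedding_meet lexI; apply/andP; split.
    apply: le_trans Ua; apply: bigmeetS; apply: image_subset; exact: subsetUl.
  apply: le_trans Vb; apply: bigmeetS; apply: image_subset; exact: subsetUr.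
Qed.

Lemma generated_proper S : ~ generated S \bot ->
  exists x, pfset x = generated S.
Proof.
move=> S0.
have ne : generated S !=set0 by exists \top; apply: generated_top.
have prop : generated S <> [set: L] by move=> ST; apply: S0; rewrite ST.
by exists (ProperFilter ne prop (@generated_up S) (@generated_meet S)).
Qed.

(** Both generated filters, when proper, are points of the frame: the first
    lies in the meet of [e @` S] and the second in the orthogonal of the join
    of [e @` T], so the inequality makes them orthogonal. *)
Lemma compact_separation S T : bigmeet (e @` S) <= bigjoin (e @` T) ->
  exists a, generated S a /\ generated (ocompl @` T) (ocompl a).
Proof.
move=> ST.
have [S0|/generated_proper[x xE]] := pselect (generated S \bot).
  by exists \bot; rewrite ocompl_bot; split=> //; apply: generated_top.
have [T0|/generated_proper[y yE]] := pselect (generated (ocompl @` T) \bot).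
  exists \top; split; first exact: generated_top.
  by rewrite -ocompl_bot ocomplK.
have Sx : bcset (bigjoin (e @` T)) x.
  move/le_bcset: ST; apply; apply/mem_bigmeet.
  by rewrite xE; apply: sub_generated.
have Ty : bcset (ocompl (bigjoin (e @` T))) y.
  have -> : ocompl (bigjoin (e @` T)) = bigmeet (e @` (ocompl @` T)).
    rewrite ocompl_bigjoin !image_comp; congr bigmeet.
    by apply: eq_imagel => a _ /=; rewrite filter_embedding_ocompl.
  by apply/mem_bigmeet; rewrite yE; apply: sub_generated.
have [a [_ xa ya]] : pf_orth x y by apply: Ty.
by exists a; rewrite -xE -yE.
Qed.

Lemma generated_ocompl T a : generated (ocompl @` T) (ocompl a) ->
  exists V, [/\ finite_set V, V `<=` T & e a <= bigjoin (e @` V)].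
Proof.
move=> [U [Ufin UT Ua]]; exists (ocompl @` U); split.
- exact: finite_image.
- by move=> _ [_ /UT[b Tb <-] <-]; rewrite ocomplK.
- by rewrite image_comp -ocompl_bigmeet_embedding ocompl_leC
    -filter_embedding_ocompl.
Qed.

Lemma filter_embedding_compact : compact_embedding e.
Proof.
move=> S T /compact_separation[a [[U [Ufin US Ua]]]].
move=> /generated_ocompl[V [Vfin VT aV]].
by exists U, V; split=> //; apply: le_trans Ua aV.
Qed.

End FilterCompletion.

Theorem proposition3p3 (d : Order.disp_t) (L : orthoLatticeType d) :
  ortho_canonical_completion
    (ocompl : biclosed (proper_filter L) -> biclosed (proper_filter L))
    (@filter_embedding d L).
Proof.
split; last exact: ocompl_sigmaE.
split; [split|exact: filter_embedding_dense|exact: filter_embedding_compact].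
- exact: filter_embedding_inj.
- exact: filter_embedding_meet.
- exact: filter_embedding_join.
- exact: filter_embedding_bot.
- exact: filter_embedding_top.
Qed.
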